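(* Let $G$ be a graph and let $k = \mathrm{td}_2(G)$. (i) If $G$ is $P_4$-free, then $\mathrm{td}(G) = k$. (ii) If $G$ is $P_5$-free, then $\mathrm{td}(G) \leq \binom{k+1}{2}$.
   Context: Graphs are finite and simple; the null graph has no vertices; connected graphs have at least one vertex. $P_t$ denotes the path on $t$ vertices. A graph $G$ is $H$-free if $G$ does not contain $H$ as an induced subgraph. A cut-vertex of a graph $G$ is a vertex $v$ such that $G-v$ has more components than $G$. A block of $G$ is a maximal connected subgraph of $G$ without a cut-vertex (so blocks are maximal 2-connected subgraphs, cut edges with their endpoints, or isolated vertices). ''$G$ is a block'' means that $G$ is connected and has no cut-vertex. Treedepth $\mathrm{td}(G)$ is defined recursively: $\mathrm{td}(G)=0$ if $G$ is the null graph; $\mathrm{td}(G)=\min_{v\in V(G)}\mathrm{td}(G-v)+1$ if $G$ is connected; $\mathrm{td}(G)=\max_i \mathrm{td}(C_i)$ if $G$ has components $C_1,\dots,C_m$ with $m>1$. 2-treedepth $\mathrm{td}_2(G)$ is defined recursively: $\mathrm{td}_2(G)=0$ if $G$ is the null graph; $\mathrm{td}_2(G)=\min_{v\in V(G)}\mathrm{td}_2(G-v)+1$ if $G$ is a block; $\mathrm{td}_2(G)=\max_i \mathrm{td}_2(B_i)$ if $G$ has blocks $B_1,\dots,B_m$ with $m>1$. *)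

(* Defs.v *)
From HB Require Import structures.
From mathcomp Require Import all_boot.

Set Implicit Arguments.
Unset Strict Implicit.
Unset Printing Implicit Defensive.

(* A finite simple graph is a pair (V, E) with V a set of vertices taken in an
   ambient finite type T and E a set of two-element subsets of V.  Keeping T
   fixed makes the subgraphs of G elements of the finite type [sgraph T]. *)
Definition wf_graph (T : finType) (g : {set T} * {set {set T}}) : bool :=
  [forall a in g.2, (a \subset g.1) && (#|a| == 2)].

Record sgraph (T : finType) : Type := SGraph {
  sgval : {set T} * {set {set T}};
  _ : wf_graph sgval
}.

HB.instance Definition _ (T : finType) := [isSub for @sgval T].
HB.instance Definition _ (T : finType) := [Finite of sgraph T by <:].

Definition vertices (T : finType) (G : sgraph T) : {set T} := (sgval G).1.
Definition edges (T : finType) (G : sgraph T) : {set {set T}} := (sgval G).2.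

Lemma edgesP (T : finType) (G : sgraph T) (a : {set T}) :
  a \in edges G -> a \subset vertices G /\ #|a| = 2.
Proof.
by case: G => g gP aE; have /forall_inP/(_ a aE)/andP[? /eqP] := gP.
Qed.

Definition adj (T : finType) (G : sgraph T) : rel T :=
  fun x y => [set x; y] \in edges G.

Definition subgraph (T : finType) (H G : sgraph T) : bool :=
  (vertices H \subset vertices G) && (edges H \subset edges G).

Lemma induced_wf (T : finType) (G : sgraph T) (A : {set T}) :
  wf_graph (vertices G :&: A, [set a in edges G | a \subset A]).
Proof.
apply/forall_inP => a /=; rewrite inE => /andP[/edgesP[aV /eqP->] aA].
by rewrite subsetI aV aA.
Qed.

Definition induced (T : finType) (G : sgraph T) (A : {set T}) : sgraph T :=
  SGraph (induced_wf G A).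

Definition del_vertex (T : finType) (G : sgraph T) (v : T) : sgraph T :=
  induced G [set~ v].

Definition path_edges (t : nat) : {set {set 'I_t}} :=
  [set a | [exists i : 'I_t, exists j : 'I_t,
     (j == i.+1 :> nat) && (a == [set i; j])]].

Lemma path_graph_wf (t : nat) : wf_graph ([set: 'I_t], path_edges t).
Proof.
apply/forall_inP => a /=; rewrite inE subsetT.
move=> /existsP[i /existsP[j /andP[/eqP ji /eqP->]]].
by rewrite cards2 -(inj_eq val_inj) /= ji neq_ltn leqnn.
Qed.

Definition path_graph (t : nat) : sgraph 'I_t := SGraph (path_graph_wf t).

Definition isomorphic (U T : finType) (H : sgraph U) (K : sgraph T) : Prop :=
  exists f : U -> T,
    [/\ {in vertices H &, injective f},
        f @: vertices H = vertices K &
        {in vertices H &, forall x y, adj H x y = adj K (f x) (f y)}].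

Definition free (U T : finType) (H : sgraph U) (G : sgraph T) : Prop :=
  ~ exists2 A : {set T}, A \subset vertices G & isomorphic H (induced G A).

Definition connected (T : finType) (G : sgraph T) : bool :=
  (vertices G != set0) &&
  [forall x in vertices G, forall y in vertices G, connect (adj G) x y].

Definition components (T : finType) (G : sgraph T) : {set sgraph T} :=
  [set induced G A | A in equivalence_partition (connect (adj G)) (vertices G)].

Definition cut_vertex (T : finType) (G : sgraph T) (v : T) : bool :=
  (v \in vertices G) && (#|components G| < #|components (del_vertex G v)|).

Definition is_block (T : finType) (G : sgraph T) : bool :=
  connected G && [forall v, ~~ cut_vertex G v].

Definition blocks (T : finType) (G : sgraph T) : {set sgraph T} :=
  [set B | [&& subgraph B G, is_block B &
     [forall B' : sgraph T,
        [&& subgraph B B', subgraph B' G & is_block B'] ==> (B' == B)]]].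

(* The minimum of f over A, for A nonempty; 0 when A is empty. *)
Definition min_over (T : finType) (A : {set T}) (f : T -> nat) : nat :=
  if [pick v in A] is Some v0 then f [arg min_(v < v0 in A) f v] else 0.

(* The recursion common to treedepth and 2-treedepth: [atom] tells when a vertex
   is removed, [parts] gives the pieces otherwise.  The bound n only makes the
   recursion structural; [td_eq] and [td2_eq] below show that starting from the
   number of vertices it never runs out. *)
Fixpoint depth_rec (T : finType) (atom : pred (sgraph T))
    (parts : sgraph T -> {set sgraph T}) (n : nat) (G : sgraph T) : nat :=
  if n is n'.+1 then
    if vertices G == set0 then 0
    else if atom G then
      (min_over (vertices G)
         (fun v => depth_rec atom parts n' (del_vertex G v))).+1
    else \max_(C in parts G) depth_rec atom parts n' C
  else 0.

Definition td (T : finType) (G : sgraph T) : nat :=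
  depth_rec (@connected T) (@components T) #|vertices G| G.

Definition td2 (T : finType) (G : sgraph T) : nat :=
  depth_rec (@is_block T) (@blocks T) #|vertices G| G.

Lemma min_overP (T : finType) (A : {set T}) (f : T -> nat) :
  A != set0 ->
  (exists2 v, v \in A & min_over A f = f v) /\
  (forall v, v \in A -> min_over A f <= f v).
Proof.
case/set0Pn => x xA; rewrite /min_over.
case: pickP => [v0 v0A|/(_ x)]; last by rewrite /= xA.
by case: arg_minnP => // v vA vmin; split=> //; exists v.
Qed.

Lemma eq_min_over (T : finType) (A : {set T}) (f g : T -> nat) :
  {in A, f =1 g} -> min_over A f = min_over A g.
Proof.
move=> fg; have [->|An0] := eqVneq A set0.
  by rewrite /min_over; case: pickP => // v; rewrite /= inE.
have [[v vA fv] fmin] := min_overP f An0.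
have [[w wA gw] gmin] := min_overP g An0.
by apply/eqP; rewrite eqn_leq {1}gw -(fg w wA) fmin //= fv (fg v vA) gmin.
Qed.

Section DepthRec.

Variables (T : finType) (atom : pred (sgraph T)).
Variable parts : sgraph T -> {set sgraph T}.
Hypothesis parts_small : forall G C, vertices G != set0 -> ~~ atom G ->
  C \in parts G -> #|vertices C| < #|vertices G|.

Let depth G := depth_rec atom parts #|vertices G| G.

Lemma card_del_vertex (G : sgraph T) (v : T) :
  v \in vertices G -> #|vertices (del_vertex G v)| < #|vertices G|.
Proof.
move=> vG; apply: proper_card; apply/properP; split; first exact: subsetIl.
by exists v => //; rewrite !inE eqxx andbF.
Qed.

Lemma depth_rec_bound (n : nat) (G : sgraph T) :
  #|vertices G| <= n -> depth_rec atom parts n G = depth G.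
Proof.
have main m : forall p q H, p <= m -> #|vertices H| <= p -> #|vertices H| <= q ->
    depth_rec atom parts p H = depth_rec atom parts q H.
  elim: m => [|m IHm] p q H.
    rewrite leqn0 => /eqP->; rewrite leqn0 cards_eq0 => H0 _.
    by case: q => [|q] //=; rewrite H0.
  case: p => [|p] pm; first rewrite leqn0 cards_eq0 => H0 _.
    by case: q => [|q] //=; rewrite H0.
  case: q => [|q] Hp; first rewrite leqn0 cards_eq0 => H0 /=.
    by rewrite H0.
  move=> Hq /=; case: ifPn => // Hn0; case: ifPn => [_|aH].
    congr _.+1; apply: eq_min_over => v /card_del_vertex vH.
    by apply: IHm => //; rewrite -ltnS (leq_trans vH).
  apply: eq_bigr => C /(parts_small Hn0 aH) CH.
  by apply: IHm => //; rewrite -ltnS (leq_trans CH).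
by move=> Gn; apply: (main n).
Qed.

Lemma depth_recE (G : sgraph T) :
  depth G =
    if vertices G == set0 then 0
    else if atom G then
      (min_over (vertices G) (fun v => depth (del_vertex G v))).+1
    else \max_(C in parts G) depth C.
Proof.
rewrite -(depth_rec_bound (leqnSn _)) /=; case: ifPn => // Gn0; case: ifPn => [_|aG].
  congr _.+1; apply: eq_min_over => v /card_del_vertex/ltnW.
  exact: depth_rec_bound.
by apply: eq_bigr => C /(parts_small Gn0 aG)/ltnW; apply: depth_rec_bound.
Qed.

End DepthRec.

Lemma adj_vertices (T : finType) (G : sgraph T) (x y : T) :
  adj G x y -> x \in vertices G /\ y \in vertices G.
Proof.
by case/edgesP => /subsetP s _; split; apply: s; rewrite !inE eqxx ?orbT.
Qed.

Lemma adj_connect_sym (T : finType) (G : sgraph T) : connect_sym (adj G).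
Proof. by apply: sym_connect_sym => x y; rewrite /adj setUC. Qed.

Lemma connect_equiv (T : finType) (G : sgraph T) :
  {in vertices G & &, equivalence_rel (connect (adj G))}.
Proof.
move=> x y z _ _ _; split; first exact: connect0.
by move=> xy; rewrite (same_connect (@adj_connect_sym _ G) xy).
Qed.

Lemma component_small (T : finType) (G C : sgraph T) :
  vertices G != set0 -> ~~ connected G -> C \in components G ->
  #|vertices C| < #|vertices G|.
Proof.
move=> Gn0; rewrite /connected Gn0 /= => nconn /imsetP[A AP ->].
have /and3P[/eqP covG _ _] := equivalence_partitionP (@connect_equiv _ G).
have AG : A \subset vertices G by rewrite -covG (bigcup_max A).
rewrite proper_card // /proper /= subsetIl; apply: contra nconn => GA.
have /eqP AE : A == vertices G.
  by rewrite eqEsubset AG (subset_trans GA) ?subsetIr.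
case/imsetP: AP => z zG Az; apply/forall_inP => x xG; apply/forall_inP => y yG.
have: x \in A by rewrite AE.
have: y \in A by rewrite AE.
rewrite Az !inE yG xG /= => zy zx.
by apply: connect_trans zy; rewrite adj_connect_sym.
Qed.

Lemma card_components_le1 (T : finType) (G : sgraph T) :
  reflect {in vertices G &, forall x y, connect (adj G) x y}
          (#|components G| <= 1).
Proof.
pose cl x := [set y in vertices G | connect (adj G) x y].
apply: (iffP idP) => [le1 x y xG yG|conn].
  have cP z : z \in vertices G -> induced G (cl z) \in components G.
    by move=> zG; apply: imset_f; apply: imset_f.
  have /(congr1 (fun H => y \in vertices H)) :=
    card_le1_eqP le1 _ _ (cP x xG) (cP y yG).
  by rewrite [LHS]inE [RHS]inE yG /= !inE yG connect0.
apply/card_le1_eqP => H K /imsetP[_ /imsetP[x xG ->] ->].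
move=> /imsetP[_ /imsetP[y yG ->] ->]; congr induced.
by apply/setP => z; rewrite !inE; case: (boolP (z \in vertices G)) => //= zG; rewrite !conn.
Qed.

Lemma is_block_spanning (T : finType) (B G : sgraph T) :
  subgraph B G -> vertices B = vertices G -> is_block B -> is_block G.
Proof.
move=> /andP[_ BG] VE.
have le1_mono (H K : sgraph T) : vertices H = vertices K ->
    edges H \subset edges K -> #|components H| <= 1 -> #|components K| <= 1.
  move=> HK /subsetP HKe /card_components_le1 conn.
  apply/card_components_le1 => x y; rewrite -HK => xH yH.
  by apply: connect_sub (conn x y xH yH) => u v uv; apply/connect1/HKe.
case/andP=> /andP[Bn0 /forall_inP Bconn] /forallP Bcut.
have B1 : #|components B| <= 1.
  by apply/card_components_le1 => x y /Bconn/forall_inP Bx /Bx.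
have G1 := le1_mono _ _ VE BG B1.
apply/andP; split.
  rewrite /connected -VE Bn0 /= VE; apply/forall_inP => x xG; apply/forall_inP => y yG.
  exact: (card_components_le1 _ G1).
apply/forallP => v; rewrite negb_and -leqNgt.
case: (boolP (v \in vertices G)) => //= vG.
have := Bcut v; rewrite negb_and -leqNgt VE vG /= => Bv.
have Gpos : 0 < #|components G|.
  rewrite card_gt0; apply/set0Pn.
  by exists (induced G [set y in vertices G | connect (adj G) v y]);
    do 2!apply: imset_f.
apply: leq_trans Gpos; apply: le1_mono (leq_trans Bv B1); first by congr (_ :&: _).
by apply/subsetP => a; rewrite !inE => /andP[/(subsetP BG)-> ->].
Qed.

Lemma block_small (T : finType) (G B : sgraph T) :
  vertices G != set0 -> ~~ is_block G -> B \in blocks G ->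
  #|vertices B| < #|vertices G|.
Proof.
move=> _ nG; rewrite inE => /and3P[sBG bB _].
rewrite proper_card // properEneq; case/andP: (sBG) => -> _; rewrite andbT.
by apply: contra nG => /eqP VE; apply: is_block_spanning bB.
Qed.

Theorem td_eq (T : finType) (G : sgraph T) :
  td G =
    if vertices G == set0 then 0
    else if connected G then
      (min_over (vertices G) (fun v => td (del_vertex G v))).+1
    else \max_(C in components G) td C.
Proof. exact/depth_recE/component_small. Qed.

Theorem td2_eq (T : finType) (G : sgraph T) :
  td2 G =
    if vertices G == set0 then 0
    else if is_block G then
      (min_over (vertices G) (fun v => td2 (del_vertex G v))).+1
    else \max_(B in blocks G) td2 B.
Proof. exact/depth_recE/block_small. Qed.

(* Main.v *)
Require Import Defs.
From HB Require Import structures.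
From mathcomp Require Import all_boot.

(* Both parameters are monotone under subgraphs, drop by at most one when a vertex
   is deleted, and drop by exactly one when a dominating vertex is deleted.

   In a connected P4-free graph G a cut vertex c is dominating, so
   td G = 1 + td C for some component C of G - c, and td (C + c) = 1 + td C; as
   C + c is smaller than G, induction on the number of vertices gives (i).

   In a connected P5-free graph with td2 <= k the set K of cut vertices is a
   clique, hence #|K| <= k.  Let D be a component of G - K and N its set of
   neighbors in K.  The graph G[D u N] is a block, so td2 (G[D u N] - v) < k for
   some v.  If #|K| < k, delete K and then v.  If #|K| = k and N = K, then v lies
   in K, since otherwise K would be a clique of size k in G[D u N] - v.
   If N <> K, P5-freeness makes every vertex of N complete to D, so
   td2 (G[D]) < k.  In all cases k deletions decrease td2 below k, and
   'C(k.+1, 2) = k + 'C(k, 2). *)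

Set Implicit Arguments.
Unset Strict Implicit.
Unset Printing Implicit Defensive.

(** * Subgraphs, connectivity, cut vertices and dominating vertices *)

Section Basics.

Variable T : finType.
Implicit Types (G H K : sgraph T) (A B : {set T}) (x y v : T).

Lemma adj_sym G x y : adj G x y = adj G y x.
Proof. by rewrite /adj setUC. Qed.

Lemma adj_irrefl G x : adj G x x = false.
Proof. by apply/negP => /edgesP[_]; rewrite setUid cards1. Qed.

Lemma adj_neq G x y : adj G x y -> x != y.
Proof. by apply: contraTneq => ->; rewrite adj_irrefl. Qed.

Lemma vertices_induced G A : vertices (induced G A) = vertices G :&: A.
Proof. by []. Qed.

Lemma adj_induced G A x y :
  adj (induced G A) x y = [&& adj G x y, x \in A & y \in A].
Proof. by rewrite /adj inE subUset !sub1set. Qed.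

Lemma induced_induced G A B : induced (induced G A) B = induced G (A :&: B).
Proof.
apply/val_inj; congr pair; first by rewrite /= !vertices_induced setIA.
by apply/setP => a; rewrite !inE subsetI andbA.
Qed.

Lemma induced_full G A : vertices G \subset A -> induced G A = G.
Proof.
move=> GA; apply/val_inj; rewrite [RHS]surjective_pairing; congr pair.
  exact/setIidPl.
apply/setP => a; rewrite inE; apply/andb_idr => /edgesP[aV _].
exact: subset_trans GA.
Qed.

Lemma subgraph_refl G : subgraph G G.
Proof. by rewrite /subgraph !subxx. Qed.

Lemma subgraph_trans H G K : subgraph G H -> subgraph H K -> subgraph G K.
Proof.
move=> /andP[v1 e1] /andP[v2 e2]; apply/andP.
by split; [apply: subset_trans v2|apply: subset_trans e2].
Qed.

Lemma subgraph_adj H G x y : subgraph H G -> adj H x y -> adj G x y.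
Proof. by case/andP=> _ /subsetP; apply. Qed.

Lemma subgraph_induced H G A :
  subgraph H G -> vertices H \subset A -> subgraph H (induced G A).
Proof.
move=> /andP[HG /subsetP eHG] HA; rewrite /subgraph vertices_induced subsetI HG HA.
apply/subsetP => a aH; rewrite inE eHG //=.
by case/edgesP: aH => aV _; apply: subset_trans HA.
Qed.

Lemma induced_subgraph G A : subgraph (induced G A) G.
Proof. by apply/andP; split; [apply: subsetIl|apply/subsetP => a; rewrite inE => /andP[]]. Qed.

Lemma induced_mono H G A B :
  subgraph H G -> vertices H :&: A \subset B ->
  subgraph (induced H A) (induced G B).
Proof.
by move=> HG AB; apply: subgraph_induced (subgraph_trans (induced_subgraph _ _) HG) AB.
Qed.

Lemma del_vertex_mono H G v :
  subgraph H G -> subgraph (del_vertex H v) (del_vertex G v).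
Proof. by move/induced_mono; apply; apply: subsetIr. Qed.

Lemma subgraph_del H G v :
  subgraph H G -> v \notin vertices H -> subgraph H (del_vertex G v).
Proof.
move=> HG vH; apply: subgraph_induced => //.
by apply/subsetP => x xH; rewrite !inE; apply: contraNneq vH => <-.
Qed.

(** The set of vertices reachable from [x] is itself closed. This turns connectivity proofs into
    arguments about an arbitrary closed set, with no walk to build. *)
Lemma closed_connected G :
  (forall A, closed (adj G) A -> forall x y, x \in vertices G ->
     y \in vertices G -> x \in A -> y \in A) ->
  {in vertices G &, forall x y, connect (adj G) x y}.
Proof.
move=> cl x y xG yG.
have := cl [set z | connect (adj G) x z] _ x y xG yG.
rewrite !inE connect0; apply=> // u w uw; rewrite !inE.
by apply: (connect_closed (@adj_connect_sym _ G)).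
Qed.

Lemma connectedP G :
  reflect (vertices G != set0 /\ {in vertices G &, forall x y, connect (adj G) x y})
          (connected G).
Proof.
apply: (iffP andP) => -[G0 c]; split=> //; last first.
  by apply/forall_inP => x xG; apply/forall_inP => y yG; apply: c.
by move=> x y xG yG; move/forall_inP: c => /(_ x xG)/forall_inP/(_ y yG).
Qed.

(** A walk from [A] to its complement has a first edge leaving [A]. With [A] chosen as a ball, this
    edge supplies the far end of an induced path. *)
Lemma connect_exit G A x y : connect (adj G) x y -> x \in A -> y \notin A ->
  exists u w, [/\ connect (adj G) x u, u \in A, w \notin A & adj G u w].
Proof.
move=> /connectP[p xp ->] xA; elim: p x xA xp => [|z p IHp] x xA /=.
  by rewrite xA.
case/andP=> xz zp; have [zA|zA _] := boolP (z \in A); last first.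
  by exists x, z; rewrite connect0.
move=> /(IHp _ zA zp)[u [w [zu uA wA uw]]]; exists u, w; split=> //.
exact: connect_trans (connect1 xz) zu.
Qed.

(** A connected graph has exactly one component, so the count in [cut_vertex] grows exactly when the
    deletion leaves at least two; a null remainder has none and does not count. *)
Lemma cut_vertexP G v : connected G ->
  reflect (v \in vertices G /\
     ~ {in vertices (del_vertex G v) &,
         forall x y, connect (adj (del_vertex G v)) x y})
    (cut_vertex G v).
Proof.
case/connectedP=> G0 Gc.
have c1 : #|components G| = 1.
  have /set0Pn[z zG] := G0; apply/eqP; rewrite eqn_leq; apply/andP; split; first exact/card_components_le1.
  rewrite card_gt0; apply/set0Pn.
  by exists (induced G [set y in vertices G | connect (adj G) z y]); do 2!apply: imset_f.
rewrite /cut_vertex c1 ltnNge; apply: (iffP andP) => -[vG nc]; split=> //.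
  by move/card_components_le1; apply/negP.
by apply/negP => /card_components_le1.
Qed.

Lemma not_cut_vertex_connect G v : connected G -> v \in vertices G ->
  ~~ cut_vertex G v ->
  {in vertices (del_vertex G v) &, forall x y, connect (adj (del_vertex G v)) x y}.
Proof.
move=> Gc vG cut; apply/card_components_le1; apply: contraR cut => lt1.
apply/cut_vertexP => //; split=> // /card_components_le1.
exact/negP.
Qed.

Lemma is_blockP G :
  reflect (connected G /\ forall v, v \in vertices G ->
     {in vertices (del_vertex G v) &,
         forall x y, connect (adj (del_vertex G v)) x y})
    (is_block G).
Proof.
apply: (iffP andP) => -[Gc cut]; split=> //.
  by move=> v vG; apply: not_cut_vertex_connect; rewrite ?(forallP cut).
apply/forallP => v; apply/negP => /cut_vertexP -/(_ Gc)[vG []]; exact: cut.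
Qed.

Definition dominating G v :=
  v \in vertices G /\ {in vertices G, forall x, x != v -> adj G v x}.

Lemma dominating_connected G v : dominating G v -> connected G.
Proof.
case=> vG dv; apply/connectedP; split; first by apply/set0Pn; exists v.
have cv x : x \in vertices G -> connect (adj G) v x.
  by move=> xG; have [->//|xv] := eqVneq x v; apply/connect1/dv.
move=> x y xG yG; apply: connect_trans (cv y yG).
by rewrite adj_connect_sym cv.
Qed.

Lemma dominating_induced G A v :
  dominating G v -> v \in A -> dominating (induced G A) v.
Proof.
move=> [vG dv] vA; split=> [|x]; first by rewrite inE vG.
by rewrite inE => /andP[xG xA] xv; rewrite adj_induced dv // vA.
Qed.

End Basics.

(** * Monotonicity, vertex deletion and dominating vertices for both depth parameters *)

(* [atom] and [parts] are [connected] and [components] for [td], [is_block] and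
   [blocks] for [td2]. *)
Section Monotone.

Variables (T : finType) (atom : pred (sgraph T)).
Variables (parts : sgraph T -> {set sgraph T}) (f : sgraph T -> nat).
Hypothesis fE : forall G, f G =
  if vertices G == set0 then 0
  else if atom G then (min_over (vertices G) (fun v => f (del_vertex G v))).+1
  else \max_(C in parts G) f C.
Hypothesis parts_small : forall G C, vertices G != set0 -> ~~ atom G ->
  C \in parts G -> #|vertices C| < #|vertices G|.
Hypothesis parts_sub : forall G C, C \in parts G -> subgraph C G.
Hypothesis atom_part : forall G H, subgraph H G -> atom H ->
  exists2 C, C \in parts G & subgraph H C.

Implicit Types (G H : sgraph T) (A : {set T}) (v : T).

Lemma depth_null G : vertices G = set0 -> f G = 0.
Proof. by move=> G0; rewrite fE G0 eqxx. Qed.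

Lemma depth_atom G : vertices G != set0 -> atom G ->
  exists2 v, v \in vertices G & f G = (f (del_vertex G v)).+1.
Proof.
move=> G0 aG; have [[v vG fv] _] := min_overP (fun v => f (del_vertex G v)) G0.
by exists v; rewrite // fE (negPf G0) aG fv.
Qed.

Lemma depth_atom_le G v : atom G -> v \in vertices G ->
  f G <= (f (del_vertex G v)).+1.
Proof.
move=> aG vG; have G0 : vertices G != set0 by apply/set0Pn; exists v.
by rewrite fE (negPf G0) aG ltnS; have [_ ->] := min_overP (fun v => f (del_vertex G v)) G0.
Qed.

Lemma depth_part_le G C : vertices G != set0 -> ~~ atom G -> C \in parts G -> f C <= f G.
Proof. by move=> G0 aG CG; rewrite [f G]fE (negPf G0) (negPf aG) leq_bigmax_cond. Qed.

Lemma depth_leP G m : vertices G != set0 -> ~~ atom G ->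
  (forall C, C \in parts G -> f C <= m) -> f G <= m.
Proof. by move=> G0 aG le; rewrite fE (negPf G0) (negPf aG); apply/bigmax_leqP. Qed.

(** Induction on the total number of vertices. If [H] is not an atom, its parts are smaller; if only
    [G] is not, [atom_part] places [H] inside one part of [G]. If both are atoms, a vertex optimal
    for [G] is deleted from both. *)
Lemma depth_mono H G : subgraph H G -> f H <= f G.
Proof.
have [n] := ubnP (#|vertices H| + #|vertices G|); elim: n H G => // n IHn H G.
rewrite ltnS => len HG; have [H0|H0] := eqVneq (vertices H) set0.
  by rewrite (depth_null H0).
have G0 : vertices G != set0.
  by case/andP: HG => sHG _; apply: contra_neq H0 => G0; apply/eqP; rewrite -subset0 -G0.
have [aH|aH] := boolP (atom H); last first.
  apply: depth_leP => // C CH; apply: IHn; last exact: subgraph_trans (parts_sub CH) HG.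
  by apply: leq_trans len; rewrite ltn_add2r parts_small.
have [aG|aG] := boolP (atom G); last first.
  have [C CG HC] := atom_part HG aH.
  apply: leq_trans (depth_part_le G0 aG CG); apply: IHn => //.
  by apply: leq_trans len; rewrite ltn_add2l parts_small.
have [v vG ->] := depth_atom G0 aG; have ltG := card_del_vertex vG.
have [vH|vH] := boolP (v \in vertices H).
  apply: leq_trans (depth_atom_le aH vH) _; rewrite ltnS.
  apply: IHn; last exact: del_vertex_mono.
  by apply: leq_trans len; rewrite -addnS leq_add // ltnW // card_del_vertex.
apply/ltnW; rewrite ltnS; apply: IHn; last exact: subgraph_del.
by apply: leq_trans len; rewrite ltn_add2l.
Qed.

(** For an atom this is the recursion. Otherwise the bound holds for each part [C] by induction, and
    [C] minus [v] is a subgraph of [G] minus [v]. *)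
Lemma depth_del G v : f G <= (f (del_vertex G v)).+1.
Proof.
have [n] := ubnP #|vertices G|; elim: n G => // n IHn G; rewrite ltnS => len.
have [vG|vG] := boolP (v \in vertices G); last first.
  by apply/leqW/depth_mono; apply: subgraph_del (subgraph_refl G) vG.
have G0 : vertices G != set0 by apply/set0Pn; exists v.
have [aG|aG] := boolP (atom G); first exact: depth_atom_le.
apply: depth_leP => // C CG; apply: leq_trans (IHn C _) _.
  exact: leq_trans (parts_small G0 aG CG) len.
by rewrite ltnS depth_mono // del_vertex_mono // parts_sub.
Qed.

Lemma depth_setD G A : f G <= #|A| + f (induced G (~: A)).
Proof.
have [n] := ubnP #|A|; elim: n A => // n IHn A; rewrite ltnS => len.
have [->|[v vA]] := set_0Vmem A; first by rewrite cards0 setC0 induced_full.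
have cA : #|A| = #|A :\ v|.+1 by rewrite (cardsD1 v) vA.
apply: leq_trans (IHn (A :\ v) _) _; first by rewrite -cA.
rewrite cA addSnnS leq_add2l; apply: leq_trans (depth_del _ v) _.
rewrite ltnS /del_vertex induced_induced depth_mono // induced_mono ?subgraph_refl //.
by apply/subsetP => x; rewrite !inE; case: (x == v) => //=; rewrite ?andbF ?andbT // => /andP[].
Qed.

(** For blocks, dominance alone does not suffice: [v] is a cut vertex when its deletion disconnects
    [G]. Hence the condition on the remaining graph. *)
Hypothesis dominating_atom : forall G v, dominating G v ->
  vertices (del_vertex G v) = set0 \/ atom (del_vertex G v) -> atom G.

(** If [G] is an atom with optimal vertex [w] other than [v], then [v] still dominates after [w] is
    deleted, and induction applies there. If [G] is not an atom, neither is [G - v]; each part [C]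
    of [G - v] is smaller, [v] dominates [C + v], and induction gives [f C < f (C + v) <= f G]. *)
Lemma depth_dominating G v : dominating G v -> f (del_vertex G v) < f G.
Proof.
have [n] := ubnP #|vertices G|; elim: n G => // n IHn G; rewrite ltnS => len dv.
have vG := dv.1; have G0 : vertices G != set0 by apply/set0Pn; exists v.
have [aG|aG] := boolP (atom G).
  have [w wG ->] := depth_atom G0 aG; rewrite ltnS.
  have [->//|wv] := eqVneq w v.
  apply: leq_trans (depth_del _ w) _.
  have -> : del_vertex (del_vertex G v) w = del_vertex (del_vertex G w) v.
    by rewrite /del_vertex !induced_induced setIC.
  apply: IHn; first exact: leq_trans (card_del_vertex wG) len.
  by apply: dominating_induced => //; rewrite !inE eq_sym.
have D0 : vertices (del_vertex G v) != set0.
  by apply: contra aG => /eqP D0; apply: dominating_atom dv _; left.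
have aD : ~~ atom (del_vertex G v).
  by apply: contra aG => aD; apply: dominating_atom dv _; right.
(* Positivity makes [f G] a successor, so the strict inequality becomes a bound by its predecessor
   on every part. *)
have fG : 0 < f G.
  have a1 : atom (induced G [set v]).
    apply: (@dominating_atom _ v); first by apply: dominating_induced; rewrite ?inE.
    by left; apply/setP => x; rewrite !inE; case: eqP; rewrite ?andbF.
  apply: leq_trans (depth_mono (induced_subgraph G [set v])).
  have [|w _ ->//] := depth_atom _ a1.
  by apply/set0Pn; exists v; rewrite !inE vG eqxx.
rewrite -(prednK fG) ltnS; apply: depth_leP => // C CD.
have fC := depth_mono (induced_subgraph G (v |: vertices C)).
have Cv : v \notin vertices C.
  apply/negP => vC; have /andP[/subsetP/(_ v vC)] := parts_sub CD.
  by rewrite !inE eqxx andbF.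
have fv : f C < f (induced G (v |: vertices C)).
  apply: leq_ltn_trans (IHn (induced G (v |: vertices C)) _ _); last first.
  - by apply: dominating_induced; rewrite // !inE eqxx.
  - apply: leq_trans len; apply: leq_ltn_trans (subset_leq_card (subsetIr _ _)) _.
    rewrite cardsU1 Cv add1n.
    by rewrite (leq_ltn_trans (parts_small D0 aD CD)) // card_del_vertex.
  - apply: depth_mono; apply: subgraph_del => //; apply: subgraph_induced; last exact: subsetUr.
    exact: subgraph_trans (parts_sub CD) (induced_subgraph _ _).
by rewrite -ltnS (prednK fG) (leq_trans fv).
Qed.

(** Every vertex of a clique dominates the graph induced on it, so the vertices can be deleted one
    by one, each deletion lowering [f]. *)
Lemma depth_clique G A : A \subset vertices G ->
  {in A &, forall x y, x != y -> adj G x y} -> #|A| <= f G.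
Proof.
have [n] := ubnP #|A|; elim: n A G => // n IHn A G; rewrite ltnS => len AG clA.
have [->|[v vA]] := set_0Vmem A; first by rewrite cards0.
have cA : #|A| = #|A :\ v|.+1 by rewrite (cardsD1 v) vA.
apply: leq_trans (depth_mono (induced_subgraph G A)).
have dv : dominating (induced G A) v.
  split=> [|x]; first by rewrite inE vA (subsetP AG).
  by rewrite inE adj_induced vA => /andP[_ xA] xv; rewrite clA 1?eq_sym.
apply: leq_trans (depth_dominating dv); rewrite cA ltnS; apply: IHn.
- by rewrite -cA.
- by apply/subsetP => x; rewrite !inE => /andP[-> xA]; rewrite xA (subsetP AG).
- move=> x y; rewrite !inE => /andP[xv xA] /andP[yv yA] xy.
  by rewrite !adj_induced !inE xv yv xA yA clA.
Qed.

End Monotone.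

(** * Specialization to treedepth and 2-treedepth *)

Section Instances.

Variable T : finType.
Implicit Types (G H : sgraph T) (A : {set T}) (x y v : T).

Definition component G x : {set T} := [set y in vertices G | connect (adj G) x y].

Lemma componentsP G H :
  reflect (exists2 x, x \in vertices G & H = induced G (component G x))
          (H \in components G).
Proof.
apply: (iffP imsetP) => [[_ /imsetP[x xG ->] ->]|[x xG ->]]; first by exists x.
by exists (component G x); first exact: imset_f.
Qed.

Lemma components_sub G C : C \in components G -> subgraph C G.
Proof. by case/componentsP=> x _ ->; apply: induced_subgraph. Qed.

Lemma connected_component G H : subgraph H G -> connected H ->
  exists2 C, C \in components G & subgraph H C.
Proof.
move=> HG /connectedP[/set0Pn[x xH] Hc].
have /subsetP sHG : vertices H \subset vertices G by case/andP: HG.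
exists (induced G (component G x)); first by apply/componentsP; exists x; rewrite ?sHG.
apply: subgraph_induced => //; apply/subsetP => y yH; rewrite inE sHG //=.
apply: connect_sub (Hc x y xH yH) => u w uw; apply/connect1.
exact: subgraph_adj HG uw.
Qed.

Lemma blocks_sub G B : B \in blocks G -> subgraph B G.
Proof. by rewrite inE => /and3P[]. Qed.

Lemma block_sub_block G H : subgraph H G -> is_block H ->
  exists2 B, B \in blocks G & subgraph H B.
Proof.
move=> HG bH; pose P B := [&& subgraph H B, subgraph B G & is_block B].
have PH : P H by rewrite /P subgraph_refl HG.
(* Subgraphs need not be induced, so vertices and edges are both counted: a subgraph with the same
   total is then equal. *)
have [B /and3P[HB BG bB] Bmax] :=
  arg_maxnP (fun B => #|vertices B| + #|edges B|) PH.
exists B; rewrite // inE BG bB; apply/forallP => B'; apply/implyP.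
case/and3P=> BB' B'G bB'; have {Bmax} := Bmax B'.
rewrite /P (subgraph_trans HB BB') B'G bB' => /(_ isT) le.
case/andP: BB' => vBB' eBB'; have le1 := subset_leq_card vBB'; have le2 := subset_leq_card eBB'.
have /eqP v1 : vertices B == vertices B'.
  rewrite eqEcard vBB' -(leq_add2r #|edges B'|) (leq_trans le) //.
  by rewrite leq_add2l.
have /eqP e1 : edges B == edges B'.
  by rewrite eqEcard eBB' -(leq_add2l #|vertices B'|) (leq_trans le) // v1.
apply/eqP/val_inj; rewrite [LHS]surjective_pairing [RHS]surjective_pairing.
by congr pair; [exact/esym/v1|exact/esym/e1].
Qed.

Lemma dominating_is_block G v : dominating G v ->
  vertices (del_vertex G v) = set0 \/ is_block (del_vertex G v) -> is_block G.
Proof.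
move=> dv D; apply/is_blockP; split; first exact: dominating_connected dv.
move=> w wG; have [->|wv] := eqVneq w v.
  by case: D => [->|/andP[/connectedP[]//]] x y; rewrite inE.
have /dominating_connected/connectedP[]// : dominating (del_vertex G w) v.
by apply: dominating_induced; rewrite // !inE eq_sym.
Qed.

Lemma td_mono H G : subgraph H G -> td H <= td G.
Proof.
exact: (depth_mono (@td_eq T) (@component_small T) components_sub
  connected_component).
Qed.

Lemma td2_mono H G : subgraph H G -> td2 H <= td2 G.
Proof.
exact: (depth_mono (@td2_eq T) (@block_small T) blocks_sub block_sub_block).
Qed.

Lemma td_del G v : td G <= (td (del_vertex G v)).+1.
Proof.
exact: (depth_del (@td_eq T) (@component_small T) components_sub
  connected_component).
Qed.

Lemma td_setD G A : td G <= #|A| + td (induced G (~: A)).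
Proof.
exact: (depth_setD (@td_eq T) (@component_small T) components_sub
  connected_component).
Qed.

Lemma td_dominating G v : dominating G v -> td (del_vertex G v) < td G.
Proof.
apply: (depth_dominating (@td_eq T) (@component_small T) components_sub
  connected_component) => {}G {}v dv _; exact: dominating_connected dv.
Qed.

Lemma td2_dominating G v : dominating G v -> td2 (del_vertex G v) < td2 G.
Proof.
exact: (depth_dominating (@td2_eq T) (@block_small T) blocks_sub
  block_sub_block dominating_is_block).
Qed.

Lemma td2_clique G A : A \subset vertices G ->
  {in A &, forall x y, x != y -> adj G x y} -> #|A| <= td2 G.
Proof.
exact: (depth_clique (@td2_eq T) (@block_small T) blocks_sub
  block_sub_block dominating_is_block).
Qed.

Lemma td_null G : vertices G = set0 -> td G = 0.
Proof. exact: depth_null (@td_eq T) _. Qed.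

Lemma is_block_connected G : is_block G -> connected G.
Proof. by case/andP. Qed.

Lemma connected_nonnull G : connected G -> vertices G != set0.
Proof. by case/andP. Qed.

(** A block is connected, so both recursions may delete the vertex that is optimal for [td].
    Otherwise every block is a smaller subgraph and [td] is monotone. *)
Lemma td2_le_td G : td2 G <= td G.
Proof.
have [n] := ubnP #|vertices G|; elim: n G => // n IHn G; rewrite ltnS => len.
have [G0|G0] := eqVneq (vertices G) set0; first by rewrite td2_eq G0 eqxx.
have [bG|bG] := boolP (is_block G); last first.
  apply: (depth_leP (@td2_eq T) G0 bG) => B BG; apply: leq_trans (IHn B _) _.
    exact: leq_trans (block_small G0 bG BG) len.
  exact/td_mono/blocks_sub.
have [v vG ->] := depth_atom (@td_eq T) G0 (is_block_connected bG).
apply: leq_trans (depth_atom_le (@td2_eq T) bG vG) _.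
by rewrite ltnS IHn // (leq_trans (card_del_vertex vG)).
Qed.

Lemma td_component G : vertices G != set0 ->
  exists2 x, x \in vertices G & td G <= td (induced G (component G x)).
Proof.
move=> G0; have [/connectedP[_ Gc]|Gc] := boolP (connected G).
  have [x xG] := set0Pn _ G0; exists x; rewrite // induced_full //.
  by apply/subsetP => y yG; rewrite inE yG Gc.
have [x0 x0G] := set0Pn _ G0.
have lt0 : 0 < #|components G|.
  by apply/card_gt0P; exists (induced G (component G x0)); apply/componentsP; exists x0.
have [C CG maxC] := eq_bigmax_cond (@td T) lt0.
have [x xG CE] := componentsP _ _ CG.
by exists x; rewrite // -CE -maxC td_eq (negPf G0) (negPf Gc).
Qed.

(** * Induced paths and cut vertices in P4-free and P5-free graphs *)

Lemma free_induced (U : finType) (P : sgraph U) G A :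
  free P G -> free P (induced G A).
Proof.
move=> fG [B BA iso]; apply: fG; exists B; first exact: subset_trans BA (subsetIl _ _).
move: iso; rewrite induced_induced; congr isomorphic; congr induced.
by apply/setIidPr; apply: subset_trans BA (subsetIr _ _).
Qed.

Lemma adj_path_graph t (i j : 'I_t) :
  adj (path_graph t) i j = (j == i.+1 :> nat) || (i == j.+1 :> nat).
Proof.
rewrite /adj inE; apply/idP/orP => [|[] e].
- case/existsP=> i' /existsP[j' /andP[/eqP ji' /eqP E]].
  have ij : i != j.
    apply/eqP => ij; move: E; rewrite ij setUid => /(congr1 (fun A : {set _} => #|A|)).
    rewrite cards1 cards2; case: eqP => // i'j'; move: ji'; rewrite i'j' => /eqP.
    by rewrite -[X in X == _]addn0 -addn1 eqn_add2l.
  have: i \in [set i'; j'] by rewrite -E !inE eqxx.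
  have: j \in [set i'; j'] by rewrite -E !inE eqxx orbT.
  rewrite !inE => /orP[]/eqP ej /orP[]/eqP ei.
  + by rewrite ej ei eqxx in ij.
  + by right; rewrite ej ei ji'.
  + by left; rewrite ej ei ji'.
  + by rewrite ej ei eqxx in ij.
- by apply/existsP; exists i; apply/existsP; exists j; rewrite e eqxx.
- by apply/existsP; exists j; apply/existsP; exists i; rewrite e setUC eqxx.
Qed.

Lemma path_not_free G x0 (s : seq T) : uniq s -> {subset s <= vertices G} ->
  (forall i j, i < j < size s -> adj G (nth x0 s i) (nth x0 s j) = (j == i.+1)) ->
  ~ free (path_graph (size s)) G.
Proof.
move=> us sG adjs; apply; pose f (i : 'I_(size s)) := nth x0 s i.
have fs i : f i \in s by apply: mem_nth.
have VE : vertices (induced G [set x in s]) = [set x in s].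
  by apply/setIidPr/subsetP => x; rewrite inE => /sG.
exists [set x in s]; first by apply/subsetP => x; rewrite inE => /sG.
exists f; split.
- by move=> i j _ _ /eqP; rewrite /f nth_uniq // => /eqP/val_inj.
- rewrite VE; apply/setP => x; rewrite inE; apply/imsetP/idP => [[i _ ->//]|xs].
  have ix : index x s < size s by rewrite index_mem.
  by exists (Ordinal ix); rewrite ?inE // /f nth_index.
- move=> i j _ _; rewrite adj_path_graph adj_induced !inE !fs !andbT /f.
  case: (ltngtP i j) => [ij|ij|/val_inj->].
  + by rewrite adjs ?ij ?ltn_ord // [_ == j.+1]ltn_eqF ?orbF // ltnW.
  + by rewrite adj_sym adjs ?ij ?ltn_ord // ltn_eqF // ltnW.
  + by rewrite adj_irrefl ltn_eqF.
Qed.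

Lemma free_P4 G a b c d : free (path_graph 4) G ->
  adj G a b -> adj G b c -> adj G c d ->
  ~~ adj G a c -> ~~ adj G a d -> ~~ adj G b d ->
  uniq [:: a; b; c; d] -> False.
Proof.
move=> fG ab bc cd /negPf ac /negPf ad /negPf bd us.
apply: (@path_not_free G a [:: a; b; c; d] us _ _ fG).
  move=> x; rewrite !inE; case/or4P=> /eqP->;
  by [case: (adj_vertices ab)|case: (adj_vertices bc)|case: (adj_vertices cd)].
by case=> [|[|[|[|i]]]] [|[|[|[|j]]]] //=; rewrite ?andbF.
Qed.

Lemma free_P5 G a b c d e : free (path_graph 5) G ->
  adj G a b -> adj G b c -> adj G c d -> adj G d e ->
  ~~ adj G a c -> ~~ adj G a d -> ~~ adj G a e ->
  ~~ adj G b d -> ~~ adj G b e -> ~~ adj G c e ->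
  uniq [:: a; b; c; d; e] -> False.
Proof.
move=> fG ab bc cd de /negPf ac /negPf ad /negPf ae /negPf bd /negPf be /negPf ce us.
apply: (@path_not_free G a [:: a; b; c; d; e] us _ _ fG).
  move=> x; rewrite !inE; case/or4P=> [||/eqP->|/orP[]] => [/eqP->|/eqP->||/eqP->|/eqP->];
  by [case: (adj_vertices ab)|case: (adj_vertices bc)|case: (adj_vertices cd)|case: (adj_vertices de)].
by case=> [|[|[|[|[|i]]]]] [|[|[|[|[|j]]]]] //=; rewrite ?andbF.
Qed.

(** [S] collects the components of [G - c] that avoid [w]. A walk from [S] to [c] can leave [S] only
    into [c], which yields [b]: a neighbor of [c] that sees nothing else outside [S], and so a ready
    first vertex for an induced path through [c]. *)
Lemma cut_vertex_side G c w : connected G -> cut_vertex G c ->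
  w \in vertices G -> w != c ->
  exists (S : {set T}) b, [/\ c \notin S, w \notin S, b \in S, adj G b c &
    forall x y, x \in S -> adj G x y -> y != c -> y \in S].
Proof.
move=> Gc /(cut_vertexP _ Gc)[cG nc] wG wc.
pose S := vertices (del_vertex G c) :\: component (del_vertex G c) w.
have clS x y : x \in S -> adj G x y -> y != c -> y \in S.
  rewrite !inE => /andP[+ /andP[xG xc]] xy yc; have [_ yG] := adj_vertices xy.
  rewrite xG xc yG yc /= andbT; apply: contra => wy.
  apply: connect_trans wy (connect1 _).
  by rewrite adj_induced adj_sym xy !inE yc.
have cS : c \notin S by rewrite !inE eqxx !andbF.
have [S0|[x xS]] := set_0Vmem S.
  case: nc => x y xG yG.
  have cw z : z \in vertices (del_vertex G c) -> connect (adj (del_vertex G c)) w z.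
    move=> zG; have: z \notin S by rewrite S0 inE.
    by rewrite inE zG andbT negbK inE => /andP[].
  apply: connect_trans (cw y yG); rewrite adj_connect_sym; exact: cw.
have xG : x \in vertices G by move: xS; rewrite !inE => /and3P[].
have [_ /(_ x c xG cG) xc] := connectedP _ Gc.
have [u [z [_ uS zS uz]]] := connect_exit xc xS cS.
have zc : z = c by apply/eqP; apply: contraNT zS => zc; apply: clS uz zc.
exists S, u; split=> //; last by rewrite -zc.
by rewrite !inE wG wc /= connect0.
Qed.

Lemma P4_free_cut_dominating G c : free (path_graph 4) G -> connected G ->
  cut_vertex G c -> dominating G c.
Proof.
move=> fG Gc cc; have cG : c \in vertices G by case/andP: cc.
split=> // w wG wc; apply/negPn/negP => cw.
have [S [b [cS wS bS bc clS]]] := cut_vertex_side Gc cc wG wc.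
(* Including [S] forces the exit edge [u z] to the other side of [c]; then [u] is a neighbor of [c],
   [z] is not, and [b c u z] is an induced P4. *)
pose A := S :|: [set x | (x == c) || adj G c x].
have wA : w \notin A by rewrite !inE (negPf wS) (negPf wc).
have cA : c \in A by rewrite !inE eqxx orbT.
have [_ /(_ c w cG wG) conn] := connectedP _ Gc.
have [u [z [_ + + uz]]] := connect_exit conn cA wA.
rewrite !inE !negb_or => uA /and3P[zS zc cz].
have uc : u != c by apply: contraNneq cz => <-.
have uS : u \notin S by apply: contra zS => uS; apply: clS uz zc.
rewrite (negPf uS) (negPf uc) /= in uA.
have bu y : y != c -> y \notin S -> ~~ adj G b y.
  by move=> yc yS; apply: contra yS => /clS; apply.
apply: (@free_P4 G b c u z) => //; rewrite ?bu //.
rewrite /= !inE !negb_or (adj_neq bc) (adj_neq uA) (adj_neq uz) [c == z]eq_sym zc.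
by rewrite (memPn uS) ?(memPn zS).
Qed.

Lemma P4_free_td_le G : free (path_graph 4) G -> td G <= td2 G.
Proof.
have [n] := ubnP #|vertices G|; elim: n G => // n IHn G; rewrite ltnS => len fG.
have [G0|G0] := eqVneq (vertices G) set0; first by rewrite td_null.
have [Gc|Gc] := boolP (connected G); last first.
  apply: (depth_leP (@td_eq T) G0 Gc) => C CG; have lt := component_small G0 Gc CG.
  apply: leq_trans (td2_mono (components_sub CG)).
  apply: IHn; first exact: leq_trans lt len.
  by have /componentsP[x _ ->] := CG; apply: free_induced.
have [bG|] := boolP (is_block G).
  have [v vG ->] := depth_atom (@td2_eq T) G0 bG.
  apply: leq_trans (depth_atom_le (@td_eq T) Gc vG) _; rewrite ltnS.
  by apply: IHn; [exact: leq_trans (card_del_vertex vG) len|exact: free_induced].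
rewrite /is_block Gc /= => /forallPn[c /negPn cc].
have dc := P4_free_cut_dominating fG Gc cc.
apply: leq_trans (td_del G c) _.
have [D0|D0] := eqVneq (vertices (del_vertex G c)) set0.
  rewrite td_null //; apply: leq_trans (td2_dominating dc); exact: ltn0Sn.
have Dc : ~~ connected (del_vertex G c).
  by apply/negP => /connectedP[_ Dc]; have [_ []] := cut_vertexP _ Gc cc.
(* Since [c] dominates, [td2 G] is positive; the successor pays for deleting [c]. *)
rewrite -(prednK (leq_ltn_trans (leq0n _) (td2_dominating dc))) ltnS.
apply: (depth_leP (@td_eq T) D0 Dc) => C CD.
rewrite -ltnS (prednK (leq_ltn_trans (leq0n _) (td2_dominating dc))).
have sC := components_sub CD; have ltC := component_small D0 Dc CD.
have Cc : c \notin vertices C.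
  case/andP: sC => /subsetP/(_ c) sC _; apply/negP => /sC.
  by rewrite !inE eqxx andbF.
apply: leq_trans (td2_mono (induced_subgraph G (c |: vertices C))).
apply: leq_trans (IHn _ _ (free_induced fG)); last first.
  apply: leq_trans len; apply: leq_ltn_trans (subset_leq_card (subsetIr _ _)) _.
  by rewrite cardsU1 Cc add1n (leq_ltn_trans ltC) // card_del_vertex // dc.1.
apply: leq_ltn_trans (td_dominating (dominating_induced dc _)); last by rewrite !inE eqxx.
apply: td_mono; apply: subgraph_del => //; apply: subgraph_induced; last exact: subsetUr.
exact: subgraph_trans sC (induced_subgraph _ _).
Qed.

Lemma P5_free_cut_adj G c1 c2 : free (path_graph 5) G -> connected G ->
  cut_vertex G c1 -> cut_vertex G c2 -> c1 != c2 -> adj G c1 c2.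
Proof.
move=> fG Gc cc1 cc2 c12; apply/negPn/negP => nadj.
have c1G : c1 \in vertices G by case/andP: cc1.
have c2G : c2 \in vertices G by case/andP: cc2.
have c21 : c2 != c1 by rewrite eq_sym.
have [S [b [c1S c2S bS bc1 clS]]] := cut_vertex_side Gc cc1 c2G c21.
have bN y : y != c1 -> y \notin S -> ~~ adj G b y.
  by move=> yc yS; apply: contra yS => /clS; apply.
have bne y : y \notin S -> b != y by move=> yS; rewrite (memPn yS).
(* The ball of radius two around [c1], together with the side [S] of [c1] that misses [c2]. *)
pose A := S :|: [set x | (x == c1) || adj G c1 x || [exists y, adj G c1 y && adj G y x]].
(* If [c2] is in the ball, a common neighbor [x] and private neighbors on both ends give the induced
   P5 [b c1 x c2 b']. *)
have [c2A|c2A] := boolP (c2 \in A).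
  have [S' [b' [c2S' c1S' b'S' b'c2 clS']]] := cut_vertex_side Gc cc2 c1G c12.
  move: c2A; rewrite !inE (negPf c2S) (negPf c21) (negPf nadj) /=.
  case/existsP=> x /andP[c1x xc2].
  have xc1 : x != c1 by rewrite eq_sym (adj_neq c1x).
  have xS : x \notin S by apply: contra c2S => xS; apply: clS xc2 c21.
  have xS' : x \notin S'.
    by apply: contra c1S' => xS'; apply: clS' xS' _ c12; rewrite adj_sym.
  have b'c1 : b' != c1 by rewrite (memPn c1S').
  have b'S : b' \notin S by apply: contra c2S => b'S; apply: clS b'c2 c21.
  have b'N y : y != c2 -> y \notin S' -> ~~ adj G y b'.
    by move=> yc; rewrite adj_sym; apply: contra => /clS'; apply.
  apply: (@free_P5 G b c1 x c2 b') => //; rewrite ?bN ?b'N //; try by rewrite adj_sym.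
  + exact: adj_neq xc2.
  rewrite /= !inE !negb_or (adj_neq bc1) (adj_neq c1x) (adj_neq xc2) !bne // c12.
  by rewrite [c1 == _]eq_sym b'c1 [x == _]eq_sym (memPn xS') // [c2 == _]eq_sym (memPn c2S').
(* Otherwise a walk to [c2] leaves the ball by an edge [u z] with [u] at distance two, and
   [b c1 x u z] is an induced P5. *)
have [_ /(_ c1 c2 c1G c2G) conn] := connectedP _ Gc.
have c1A : c1 \in A by rewrite !inE eqxx orbT.
have [u [z [_ + + uz]]] := connect_exit conn c1A c2A.
rewrite !inE !negb_or => uA /and3P[zS /andP[zc c1z] /existsPn nz].
have uc : u != c1 by apply: contraNneq c1z => <-.
have c1u : ~~ adj G c1 u by apply/negP => c1u; have := nz u; rewrite c1u uz.
have uS : u \notin S by apply: contra zS => uS; apply: clS uz zc.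
rewrite (negPf uS) (negPf uc) (negPf c1u) /= in uA.
have /existsP[x /andP[c1x xu]] := uA.
have xc1 : x != c1 by rewrite eq_sym (adj_neq c1x).
have xS : x \notin S by apply: contra uS => xS; apply: clS xu uc.
have xz : ~~ adj G x z by have := nz x; rewrite c1x.
apply: (@free_P5 G b c1 x u z) => //; rewrite ?bN //.
rewrite /= !inE !negb_or (adj_neq bc1) (adj_neq c1x) (adj_neq xu) (adj_neq uz) !bne //.
rewrite [c1 == u]eq_sym uc [c1 == z]eq_sym zc /= andbT.
by apply: contraNneq c1z => <-.
Qed.

End Instances.

(** * A component of the graph left after deleting a clique that contains all cut vertices *)

Section CliqueOfCutVertices.

Variables (T : finType) (G : sgraph T) (K : {set T}) (x : T).
Hypothesis Gc : connected G.
Hypothesis clique : {in K &, forall y z, y != z -> adj G y z}.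
Hypothesis not_cut : forall v, v \notin K -> ~~ cut_vertex G v.
Let H := induced G (~: K).
Hypothesis xH : x \in vertices H.
Let D := component H x.
Let N := [set n in K | [exists d in D, adj G n d]].

Lemma in_component y : y \in D -> y \in vertices G /\ y \notin K.
Proof. by rewrite !inE => /andP[/andP[]]. Qed.

Lemma component_neighbor y z : y \in D -> adj G y z -> z \in D :|: N.
Proof.
move=> yD yz; have [zK|zK] := boolP (z \in K); rewrite inE; apply/orP.
  by right; rewrite inE zK; apply/exists_inP; exists y; rewrite // adj_sym.
left; have [_ zG] := adj_vertices yz; have [yG yK] := in_component yD.
move: yD; rewrite !inE zG zK => /andP[_ xy].
by apply: connect_trans xy (connect1 _); rewrite adj_induced yz !inE yK.
Qed.

Lemma component_connect y z : y \in D -> z \in D -> connect (adj H) y z.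
Proof.
rewrite !inE => /andP[_ xy] /andP[_ xz].
by apply: connect_trans xz; rewrite adj_connect_sym.
Qed.

Lemma component_exit (A : {set T}) y z :
  y \in D -> z \in D -> y \in A -> z \notin A ->
  exists u w, [/\ u \in D, w \in D, u \in A, w \notin A & adj G u w].
Proof.
move=> yD zD yA zA.
have [u [w [yu uA wA]]] := connect_exit (component_connect yD zD) yA zA.
rewrite adj_induced => uw; exists u, w.
have uG : u \in vertices H.
  by case/and3P: uw => /adj_vertices[uG _] uK _; rewrite inE uG.
have uD : u \in D.
  by rewrite inE uG; move: yD; rewrite inE => /andP[_ xy]; apply: connect_trans yu.
split=> //; last by case/and3P: uw.
case/and3P: uw => uw _ wK; have := component_neighbor uD uw.
by rewrite inE => /orP[//|]; rewrite inE => /andP[wK']; rewrite inE wK' in wK.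
Qed.

(** [D] is connected and each vertex of [N'] has a neighbor in it. Arbitrary [N'] covers both [N]
    and [N] with one vertex deleted. *)
Lemma connect_component_neighbors (N' : {set T}) : N' \subset N ->
  {in vertices (induced G (D :|: N')) &,
     forall y z, connect (adj (induced G (D :|: N'))) y z}.
Proof.
move=> N'N; apply: closed_connected => A clA y z yV zV yA.
have nbr n : n \in N' -> exists2 d, d \in D & (n \in A) = (d \in A).
  move=> nN'; have := subsetP N'N n nN'; rewrite inE => /andP[nK /exists_inP[d dD nd]].
  by exists d => //; apply: clA; rewrite adj_induced nd !in_setU dD nN' orbT.
have DA d e : d \in D -> e \in D -> d \in A -> e \in A.
  move=> dD eD dA; apply/negPn/negP => eA.
  have [u [w [uD wD uA wA uw]]] := component_exit dD eD dA eA.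
  have /clA : adj (induced G (D :|: N')) u w.
    by rewrite adj_induced uw !in_setU uD wD.
  by rewrite uA (negPf wA).
have [d dD dA] : exists2 d, d \in D & d \in A.
  move: yV; rewrite vertices_induced => /setIP[_ /setUP[yD|/nbr[d dD yd]]]; first by exists y.
  by exists d; rewrite // -yd.
move: zV; rewrite vertices_induced => /setIP[_ /setUP[zD|/nbr[e eD ->]]]; exact: DA dA.
Qed.

(** Deleting a vertex of [N] keeps [D] connected with the rest of [N] attached. A vertex [v] of [D]
    lies outside [K], hence is no cut vertex of [G], and connectivity of [G - v] is carried over to
    [D :|: N]. *)
Lemma component_block : is_block (induced G (D :|: N)).
Proof.
have xD : x \in D by rewrite inE xH connect0.
have [xG _] := in_component xD.
apply/is_blockP; split.
  apply/connectedP; split; last exact: connect_component_neighbors (subxx _).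
  by apply/set0Pn; exists x; rewrite vertices_induced in_setI in_setU xG xD.
move=> v; rewrite vertices_induced => /setIP[vG vB].
have [vD|vD] := boolP (v \in D); last first.
  have vN : v \in N by move: vB; rewrite inE (negPf vD).
  rewrite /del_vertex induced_induced.
  suff -> : (D :|: N) :&: [set~ v] = D :|: (N :\ v).
    exact/connect_component_neighbors/subsetDl.
  apply/setP => y; rewrite in_setI !in_setU in_setD1 in_setC1.
  by have [->|_] := eqVneq y v; rewrite ?(negPf vD) ?andbF ?andbT.
have [_ vK] := in_component vD.
have vN : v \notin N by rewrite inE (negPf vK).
rewrite /del_vertex induced_induced; set B := _ :&: _.
have inB y : (y \in B) = (y != v) && (y \in D :|: N).
  by rewrite in_setI in_setC1 andbC.
have NB n : n \in N -> n \in B.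
  by move=> nN; rewrite inB in_setU nN orbT andbT; apply: contraNneq vN => <-.
have NG n : n \in N -> n \in vertices G.
  by rewrite inE => /andP[_ /exists_inP[d _ /adj_vertices[]]].
have Gv := not_cut_vertex_connect Gc vG (not_cut vK).
(* Only N sees vertices outside D u N, so a component of G[D u N] - v that misses
   N would also be a component of the connected graph G - v. *)
have full (A : {set T}) y z : closed (adj (induced G B)) A ->
    {in N, forall n, n \notin A} -> y \in vertices G -> y \in B -> y \in A ->
    z \in vertices G -> z != v -> z \in A.
  move=> clA NA yG yB yA zG zv; apply/negPn/negP => zA.
  have /andP[yv _] : (y != v) && (y \in D :|: N) by rewrite -inB.
  have yz : connect (adj (del_vertex G v)) y z by apply: Gv; rewrite !inE ?yG ?zG.
  have yAB : y \in A :&: B by rewrite inE yA.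
  have zAB : z \notin A :&: B by rewrite inE (negPf zA).
  have [u [w [_ /setIP[uA uB] wAB]]] := connect_exit yz yAB zAB.
  rewrite adj_induced !in_setC1 => /and3P[uw _ wv].
  have uD : u \in D.
    by move: uB; rewrite inB in_setU => /andP[_ /orP[//|/NA]]; rewrite uA.
  have wB : w \in B by rewrite inB wv (component_neighbor uD uw).
  have /clA : adj (induced G B) u w by rewrite adj_induced uw uB.
  by move=> uwA; rewrite in_setI -uwA uA wB in wAB.
apply: closed_connected => A clA y z; rewrite vertices_induced.
move=> /setIP[yG yB] /setIP[zG zB] yA.
have zv : z != v by move: zB; rewrite inB => /andP[].
(* [N] is a clique, so a closed set contains all of it or none of it; thus [A] or its complement
   misses [N], and [full] applies to that one. *)
have [/exists_inP[n nN nA]|/exists_inPn NA] := boolP [exists n in N, n \in A]; last first.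
  exact: full clA NA yG yB yA zG zv.
apply/negPn/negP => zA.
have clA' : closed (adj (induced G B)) (~: A).
  by move=> u w /clA uw; rewrite !in_setC uw.
have NA m : m \in N -> m \notin ~: A.
  move=> mN; rewrite in_setC negbK; have [->//|mn] := eqVneq m n.
  rewrite -(clA n m) // adj_induced !NB // clique ?andbT 1?eq_sym //.
  - by move: nN; rewrite inE => /andP[].
  - by move: mN; rewrite inE => /andP[].
have yv : y != v by move: yB; rewrite inB => /andP[].
have := full _ z y clA' NA zG zB _ yG yv; rewrite !in_setC yA zA.
by move/(_ isT).
Qed.

End CliqueOfCutVertices.

(** * The binomial bound for P5-free graphs *)

Lemma P5_free_td_le (T : finType) k (G : sgraph T) :
  free (path_graph 5) G -> td2 G <= k -> td G <= 'C(k.+1, 2).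
Proof.
elim: k G => [|k IHk] G.
  rewrite leqn0 => _ /eqP t0; rewrite td_null //; apply/setP => x; rewrite inE.
  apply/negP => xG; have := @td2_clique _ G [set x].
  rewrite sub1set cards1 t0 => /(_ xG) clx.
  suff: 1 <= 0 by [].
  by apply: clx => y z; rewrite !inE => /eqP-> /eqP->; rewrite eqxx.
(* The inner induction only reduces to connected [G]; the outer one, on [k], is used after the
   deletions. *)
have [n] := ubnP #|vertices G|; elim: n G => // n IHn G; rewrite ltnS => len fG tk.
have [G0|G0] := eqVneq (vertices G) set0; first by rewrite td_null.
have [Gc|Gc] := boolP (connected G); last first.
  apply: (depth_leP (@td_eq T) G0 Gc) => C CG; have lt := component_small G0 Gc CG.
  apply: IHn; first exact: leq_trans lt len.
    by have /componentsP[x _ ->] := CG; apply: free_induced.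
  exact: leq_trans (td2_mono (components_sub CG)) tk.
pose K := [set v | cut_vertex G v].
have KG : K \subset vertices G by apply/subsetP => v; rewrite inE => /andP[].
have clK : {in K &, forall y z, y != z -> adj G y z}.
  by move=> y z; rewrite !inE => cy cz; apply: P5_free_cut_adj.
have nK v : v \notin K -> ~~ cut_vertex G v by rewrite inE.
have Kk : #|K| <= k.+1 := leq_trans (td2_clique KG clK) tk.
(* Pascal's rule splits the bound into a budget of [k.+1] deletions and the bound for [k]. *)
rewrite binS bin1 addnC; apply: leq_trans (td_setD G K) _.
have [H0|H0] := eqVneq (vertices (induced G (~: K))) set0.
  by rewrite td_null // addn0 (leq_trans Kk) // leq_addr.
have [x xH tdH] := td_component H0; apply: leq_trans (leq_add (leqnn _) tdH) _.
set D := component _ x; rewrite induced_induced.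
have xD : x \in D by rewrite inE xH connect0.
pose N := [set n in K | [exists d in D, adj G n d]].
have bB : is_block (induced G (D :|: N)) := component_block Gc clK nK xH.
have DK y : y \in D -> y \notin K by case/in_component.
have sDK : subgraph (induced G (~: K :&: D)) (induced G D).
  by apply: induced_mono (subgraph_refl G) _; rewrite setIA subsetIr.
apply: leq_trans (leq_add (leqnn _) (td_mono sDK)) _.
have sDB : subgraph (induced G D) (induced G (D :|: N)).
  by apply: induced_mono (subgraph_refl G) _; rewrite subIset // subsetUl orbT.
have [v vB tB] := depth_atom (@td2_eq T) (connected_nonnull (is_block_connected bB)) bB.
have {tB} tv : td2 (del_vertex (induced G (D :|: N)) v) <= k.
  by rewrite -ltnS -tB (leq_trans (td2_mono (induced_subgraph _ _))).
(* If [K] does not exhaust the budget, one deletion is left for [v]. Otherwise [td2] of the graph on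
   [D] must already be at most [k]. *)
have [ltK|geK] := ltnP #|K| k.+1.
  apply: leq_trans (leq_add (leqnn _) (td_del _ v)) _.
  rewrite addnS -addSn leq_add // IHk //; first exact/free_induced/free_induced.
  by apply: leq_trans tv; apply/td2_mono/del_vertex_mono.
apply: leq_add Kk (IHk _ (free_induced fG) _).
have [/subsetP KN|/subsetPn[c' c'K c'N]] := boolP (K \subset N).
  apply: leq_trans (tv); apply/td2_mono/subgraph_del => //.
  rewrite vertices_induced in_setI negb_and; apply/orP; right.
  (* A vertex [v] of [K] is not in [D], so its deletion leaves the graph on [D] untouched. *)
  suff vK : v \in K by apply/negP => /DK; rewrite vK.
  apply/negPn/negP => vK; suff: k.+1 <= k by rewrite ltnn.
  apply: leq_trans tv; apply: leq_trans geK _.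
  have KB y : y \in K -> y \in (D :|: N) :&: [set~ v].
    by move=> yK; rewrite in_setI in_setU KN // orbT in_setC1; apply: contraNneq vK => <-.
  rewrite /del_vertex induced_induced; apply: td2_clique.
    by apply/subsetP => y yK; rewrite vertices_induced in_setI KB // (subsetP KG).
  by move=> y z yK zK yz; rewrite adj_induced clK // !KB.
have c'G := subsetP KG c' c'K.
have c'cut : cut_vertex G c' by move: c'K; rewrite inE.
have xG : x \in vertices G by move: xH; rewrite inE => /andP[].
have c'D : c' \notin D by apply: contraL c'K => /DK.
have [_ /(_ x c' xG c'G) xc'] := connectedP _ Gc.
(* Connectivity of [G] provides a vertex [c] of [N]: the first vertex outside [D] on a walk from [x]
   to [c']. *)
have [d [c [_ dD cD dc]]] := connect_exit xc' xD c'D.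
have cN : c \in N.
  by have := component_neighbor dD dc; rewrite inE => /orP[/(negP cD)|].
have cK : c \in K by move: cN; rewrite inE => /andP[].
have cc' : c != c' by apply: contraNneq c'N => <-.
have c'adj y : y \in D -> ~~ adj G y c'.
  move=> yD; apply: contra c'N => yc'; rewrite inE c'K.
  by apply/exists_inP; exists y; rewrite // adj_sym.
(* c lies in N and c' in K \ N: a vertex of D at distance two from c would start
   an induced P5 passing through c and c'. *)
have dom : {in D, forall y, adj G c y}.
  move=> y yD; apply/negPn/negP => cy.
  have dA : d \in [set z | adj G c z] by rewrite inE adj_sym.
  have yA : y \notin [set z | adj G c z] by rewrite inE.
  have [u [w [uD wD]]] := component_exit dD yD dA yA.
  rewrite !inE => cu cw uw.
  have cG := subsetP KG c cK.
  (* As [c'] is a cut vertex, it has a neighbor [b] on a side away from [c]; the induced P5 is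
     [w u c c' b]. *)
  have [S [b [c'S cS bS bc' clS]]] := cut_vertex_side Gc c'cut cG cc'.
  have nc' z : z \in D -> z != c' by move=> zD; apply: contraNneq c'D => <-.
  have uS : u \notin S by apply: contra cS => uS; apply: clS uS _ cc'; rewrite adj_sym.
  have wS : w \notin S by apply: contra uS => wS; apply: clS wS _ (nc' u uD); rewrite adj_sym.
  have bN z : z != c' -> z \notin S -> ~~ adj G z b.
    by move=> zc; rewrite adj_sym; apply: contra => /clS; apply.
  have bne z : z \notin S -> z != b by move=> zS; rewrite eq_sym (memPn zS).
  have [uc' wc'] := (nc' u uD, nc' w wD).
  have adj_cc' : adj G c c' by apply: clK.
  apply: (@free_P5 _ G w u c c' b) => //; rewrite ?bN ?c'adj //; try by rewrite adj_sym.
  rewrite /= !inE !negb_or eq_sym (adj_neq uw) !bne // uc' wc' cc'.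
  by rewrite [u == c]eq_sym (adj_neq cu) !andbT; apply: contraNneq cD => <-.
(* With [c] complete to [D], deleting [c] lowers [td2], so the graph on [D] lies strictly below
   [td2 G]. *)
have cB : dominating (induced G (c |: D)) c.
  split=> [|y]; first by rewrite vertices_induced in_setI setU11 (subsetP KG).
  rewrite vertices_induced => /setIP[_ yD] yc; rewrite adj_induced setU11 yD andbT.
  by move: yD; rewrite in_setU1 (negPf yc) => /dom->.
rewrite -ltnS; apply: leq_trans tk; apply: leq_trans (td2_mono (induced_subgraph G (c |: D))).
apply: leq_ltn_trans (td2_dominating cB); apply/td2_mono/subgraph_del.
  by apply: induced_mono (subgraph_refl G) _; rewrite subIset // subsetUr orbT.
by rewrite vertices_induced in_setI (negPf cD) andbF.
Qed.

Theorem theorem3 (T : finType) (G : sgraph T) (k : nat) (hk : k = td2 G) :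
  (free (path_graph 4) G -> td G = k) /\
  (free (path_graph 5) G -> td G <= 'C(k.+1, 2)).
Proof.
split=> fG; last by apply: P5_free_td_le; rewrite ?hk.
by apply/eqP; rewrite hk eqn_leq P4_free_td_le // td2_le_td.
Qed.
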